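(* For every $\varepsilon>0$ there is an $\eta>0$ such that for all sufficiently large $n$ the following holds: if $\mathcal{F}$ is a maximal $3$-wise intersecting family of subsets of $[n]$ with $|\mathcal{F}| \le (1+\eta)2^{(n+2)/2}$, then $n$ is even and there is a balanced pair of linked cubes $\mathcal{L}$ over $[n]$ such that all but at most $\varepsilon|\mathcal{F}|$ members of $\mathcal{F}$ belong to $\mathcal{L}$.
   Context: A family $\mathcal{F}$ of subsets of $[n]=\{1,\ldots,n\}$ is $k$-wise intersecting if every collection of at most $k$ members of $\mathcal{F}$ has a common element; it is maximal $k$-wise intersecting if moreover no subset of $[n]$ outside $\mathcal{F}$ can be added to $\mathcal{F}$ while preserving this property. A pair of linked cubes is a family of the form $\{A : S \subsetneq A \subseteq [n]\} \cup \{B : [n]\setminus S \subsetneq B \subseteq [n]\}$ for some $S \subseteq [n]$; it is balanced if $\lfloor n/2\rfloor \le |S| \le \lceil n/2 \rceil$. *)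

(* Defs.v *)
From mathcomp Require Import all_boot.
From Stdlib Require Import Reals.
Set Implicit Arguments. Unset Strict Implicit. Unset Printing Implicit Defensive.

Definition kwise_intersecting (n k : nat) (F : {set {set 'I_n}}) : Prop :=
  forall G : {set {set 'I_n}}, G \subset F -> (0 < #|G| <= k)%N ->
    exists x : 'I_n, forall A, A \in G -> x \in A.

Definition maximal_kwise_intersecting (n k : nat) (F : {set {set 'I_n}}) : Prop :=
  kwise_intersecting k F /\
  forall A : {set 'I_n}, A \notin F -> ~ kwise_intersecting k (A |: F).

Definition linked_cubes (n : nat) (S : {set 'I_n}) : {set {set 'I_n}} :=
  [set A : {set 'I_n} | S \proper A] :|: [set B : {set 'I_n} | (~: S) \proper B].

Definition balanced (n : nat) (S : {set 'I_n}) : Prop :=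
  (n./2 <= #|S| <= uphalf n)%N.

(* Main.v *)
From mathcomp Require Import all_boot zify.
Require Import Defs.
From Stdlib Require Import Reals Lra.
(* [Reals] hides the arithmetic notations of [ssrnat]. *)
From mathcomp Require Import ssrnat.
Set Implicit Arguments. Unset Strict Implicit. Unset Printing Implicit Defensive.

(** Let [G] be the family of complements of members of [F], with [m] members.
    By maximality [F] is an up-set and every set outside [F] is a disjoint union
    of two members of [G], so the disjointness graph on [G] has at least
    [2 ^ n - m], that is almost [m ^ 2 / 4], edges. It has [o(m ^ 3)] triangles,
    by a blow-up argument in the style of Alon and Frankl. Hence for some edge [AB]
    the neighbourhoods [X] of [A] and [Y] of [B] almost partition [G], contain few
    edges, and almost every pair in [X * Y] is disjoint. Each element of [n] must
    be frequent in [X] or in [Y], since half of all sets contain it; as an element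
    frequent in [X] belongs to few members of [Y], the set [S] of elements frequent
    in [X] satisfies: almost all of [X] lies below [S] and almost all of [Y] below
    its complement. Then [2 ^ |S| + 2 ^ (n - |S|)] is at most about
    [2 * 2 ^ (n / 2)], which forces [|S| = n / 2]. *)

(** * Sums and cardinalities *)

Lemma exists_leq_of_leq_sum (I : finType) (A : {pred I}) (f g : I -> nat) :
  0 < #|A| -> \sum_(i in A) f i <= \sum_(i in A) g i ->
  exists2 i, i \in A & f i <= g i.
Proof.
move=> A_gt0 le_fg; apply/exists_inP; apply: contraLR le_fg.
rewrite negb_exists_in -ltnNge => /forall_inP lt_gf.
suff: \sum_(i in A) (g i + 1) <= \sum_(i in A) f i.
  by rewrite big_split sum1_card /=; lia.
by apply: leq_sum => i /lt_gf; rewrite -ltnNge addn1.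
Qed.

Lemma chebyshev_sum (I : finType) (A : {pred I}) (f g : I -> nat) :
  {in A &, forall i j, f i <= f j -> g i <= g j} ->
  (\sum_(i in A) f i) * (\sum_(i in A) g i) <= #|A| * \sum_(i in A) f i * g i.
Proof.
move=> mono_fg.
have rearrangement i j : i \in A -> j \in A ->
    f i * g j + f j * g i <= f i * g i + f j * g j.
  move=> iA jA; have := mono_fg i j iA jA; have := mono_fg j i jA iA.
  by case: (leqP (f i) (f j)) => [le_f _ /(_ isT)|/ltnW le_f /(_ le_f) + _]; nia.
have : \sum_(i in A) \sum_(j in A) (f i * g j + f j * g i) <=
       \sum_(i in A) \sum_(j in A) (f i * g i + f j * g j).
  by apply: leq_sum => i iA; apply: leq_sum => j; exact: rearrangement.
under eq_bigr do rewrite big_split.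
under [X in _ <= X]eq_bigr do rewrite big_split.
rewrite !big_split /= [X in _ + X <= _]exchange_big [X in _ <= _ + X]exchange_big /=.
rewrite -big_distrlr.
under [X in _ <= X + _]eq_bigr do rewrite sum_nat_const.
under [X in _ <= _ + X]eq_bigr do rewrite sum_nat_const.
by rewrite -big_distrr /= !addnn leq_double.
Qed.

Lemma power_mean (I : finType) (A : {pred I}) (f : I -> nat) (t : nat) :
  (\sum_(i in A) f i) ^ t.+1 <= #|A| ^ t * \sum_(i in A) f i ^ t.+1.
Proof.
elim: t => [|t IH]; first by rewrite expn1 mul1n.
rewrite expnS (leq_trans (leq_mul (leqnn _) IH)) // mulnCA [#|A| ^ t.+1]expnSr -mulnA.
rewrite leq_mul2l; under [X in _ || (_ <= _ * X)]eq_bigr do rewrite expnS.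
by rewrite chebyshev_sum ?orbT // => i j _ _ le_f; rewrite leq_exp2r.
Qed.

Lemma leq_expn_sum_card_ffun (I J : finType) (X : {set I}) (P : I -> {set J}) (t : nat) :
  (\sum_(x in X) #|P x|) ^ t.+1 <=
  #|X| ^ t * \sum_(a : {ffun 'I_t.+1 -> J}) #|[set x in X | [forall i, a i \in P x]]|.
Proof.
apply: leq_trans (power_mean _ _ _) _; rewrite leq_mul2l; apply/orP; right.
under eq_bigr => x _ do rewrite -[t.+1]card_ord -card_ffun_on -sum1_card.
rewrite (exchange_big_dep predT) //=; apply: leq_sum => a _.
rewrite sum1_card subset_leq_card //; apply/subsetP => x.
by rewrite !inE.
Qed.

Lemma leq_mul_expn_gap (a b c n : nat) :
  0 < a -> a < b -> c * a <= n -> c * a ^ n <= b ^ n.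
Proof.
move=> a_gt0 lt_ab le_n.
have bernoulli : (a + n) * a ^ n <= a * a.+1 ^ n.
  by elim: (n) => [|k IH]; [rewrite addn0 | rewrite !expnS; nia].
have le_pow : a.+1 ^ n <= b ^ n by case: (n) => // k; rewrite leq_exp2r.
apply: leq_trans le_pow; rewrite -(leq_pmul2l a_gt0) mulnA (leq_trans _ bernoulli) //.
by rewrite leq_mul2r mulnC; apply/orP; right; lia.
Qed.

Lemma leq_add_divn (c p q : nat) : 0 < c -> c * q <= (c + 1) * p -> q <= p + q %/ c.
Proof.
move=> c_gt0 le_q; rewrite -leq_subLR; case: (leqP q p) => [|lt_pq].
  by rewrite -subn_eq0 => /eqP->.
by rewrite leq_divRL // mulnBl; lia.
Qed.

Lemma card_sets (T : finType) : #|{set T}| = 2 ^ #|T|.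
Proof. by rewrite -[#|T|]cardsT -card_powerset powersetT cardsT. Qed.

Lemma card_sets_containing (T : finType) (x : T) :
  2 ^ #|T| = 2 * #|[set C : {set T} | x \in C]|.
Proof.
set W := [set C | _].
suff cardCW : #|~: W| = #|W| by rewrite -card_sets -(cardsC W) cardCW mul2n addnn.
by rewrite -(card_preimset W (@setC_inj T)); apply: eq_card => C; rewrite !inE.
Qed.

Lemma card_ffun_small_bigcup (T I : finType) (r : nat) :
  #|[set a : {ffun I -> {set T}} | #|\bigcup_i a i| <= r]| <= 2 ^ #|T| * (2 ^ r) ^ #|I|.
Proof.
pose fits (U : {set T}) := [set a : {ffun I -> {set T}} |
  (#|U| <= r) && (a \in ffun_on (mem (powerset U)))].
have card_fits U : #|fits U| <= (2 ^ r) ^ #|I|.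
  case: (leqP #|U| r) => [le_Ur|lt_rU]; last first.
    by rewrite (eq_card0 (A := fits U)) // => a; rewrite inE leqNgt lt_rU.
  apply: (@leq_trans #|ffun_on_mem I (mem (powerset U))|).
    by apply/subset_leq_card/subsetP => a; rewrite inE => /andP[].
  by rewrite card_ffun_on card_powerset; case: #|I| => // t; rewrite leq_exp2r // leq_exp2l.
have sub_fits : [set a : {ffun I -> {set T}} | #|\bigcup_i a i| <= r] \subset \bigcup_U fits U.
  apply/subsetP => a; rewrite inE => le_r; apply/bigcupP; exists (\bigcup_i a i) => //.
  rewrite inE le_r; apply/ffun_onP => i; rewrite inE; exact: bigcup_sup.
apply: leq_trans (subset_leq_card sub_fits) _.
rewrite -card_sets -sum_nat_const.
elim/big_ind2: _ => [||U _] //; first by rewrite cards0.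
by move=> A a B b le_A le_B; rewrite (leq_trans (leq_card_setU _ _).1) // leq_add.
Qed.

(** * Graphs with few triangles *)

Section Arcs.

Variables (V : finType) (adj : rel V).
Implicit Types (G X Y : {set V}) (u v : V).

Definition neighbours Y u : {set V} := [set v in Y | adj u v].

Definition arcs X Y : {set V * V} := [set p in setX X Y | adj p.1 p.2].

(* Each triangle is counted once for each of its six orderings. *)
Definition triangles G : nat :=
  \sum_(u in G) #|arcs (neighbours G u) (neighbours G u)|.

Lemma sum_arcs X Y (f : V -> V -> nat) :
  \sum_(p in arcs X Y) f p.1 p.2 = \sum_(u in X) \sum_(v in neighbours Y u) f u v.
Proof. by rewrite pair_big_dep; apply: eq_bigl => p; rewrite !inE andbA. Qed.

Lemma sum_arcs_fst X Y (f : V -> nat) :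
  \sum_(p in arcs X Y) f p.1 = \sum_(u in X) #|neighbours Y u| * f u.
Proof.
by rewrite (sum_arcs X Y (fun u _ => f u)); apply: eq_bigr => u _; rewrite sum_nat_const.
Qed.

Lemma card_arcs X Y : #|arcs X Y| = \sum_(u in X) #|neighbours Y u|.
Proof. by rewrite -sum1_card (sum_arcs_fst X Y (fun=> 1)); under eq_bigr do rewrite muln1. Qed.

Lemma arcs_sub_setX X Y : arcs X Y \subset setX X Y.
Proof. by apply/subsetP => p; rewrite inE => /andP[]. Qed.

Lemma leq_card_arcs X Y : #|arcs X Y| <= #|X| * #|Y|.
Proof. by rewrite -cardsX subset_leq_card ?arcs_sub_setX. Qed.

Lemma triangles_sum_arcs G :
  triangles G = \sum_(p in arcs G G) #|neighbours G p.1 :&: neighbours G p.2|.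
Proof.
rewrite (sum_arcs G G (fun u v => #|neighbours G u :&: neighbours G v|)).
apply: eq_bigr => u _; rewrite card_arcs; apply: eq_bigr => v _.
by apply: eq_card => w; rewrite !inE; case: (w \in G); rewrite ?andbT.
Qed.

Hypothesis adj_sym : symmetric adj.

Lemma sum_arcsC X Y (f : V -> V -> nat) :
  \sum_(p in arcs X Y) f p.1 p.2 = \sum_(p in arcs Y X) f p.2 p.1.
Proof.
pose swap (p : V * V) := (p.2, p.1); have swapK : involutive swap by case.
rewrite (reindex_inj (inv_inj swapK)) /=; apply: eq_bigl => p.
by rewrite !inE /= adj_sym [(_ \in X) && _]andbC.
Qed.

Lemma card_arcsC X Y : #|arcs X Y| = #|arcs Y X|.
Proof. by rewrite -!sum1_card (sum_arcsC _ _ (fun _ _ => 1)). Qed.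

(* Average over the arcs: since [deg u + deg v] sums to [2 * \sum_u deg u ^ 2],
   Cauchy-Schwarz makes its average at least [2 * #|arcs G G| / #|G|], while the
   quantities on the left are sums over triangles. *)
Lemma exists_spanning_arc G :
  let m := #|G| in let N := neighbours G in let E := #|arcs G G| in
  0 < E ->
  exists2 p, p \in arcs G G &
    E * (2 * m * #|N p.1 :&: N p.2| + (#|arcs (N p.1) (N p.1)| + #|arcs (N p.2) (N p.2)|))
      + 2 * E ^ 2
    <= E * (m * (#|N p.1| + #|N p.2|)) + 4 * m * triangles G.
Proof.
move=> m N E E_gt0; apply: exists_leq_of_leq_sum => //.
have sum_ends (f : V -> nat) :
    \sum_(p in arcs G G) (f p.1 + f p.2) = 2 * \sum_(u in G) #|N u| * f u.
  by rewrite big_split /= (sum_arcsC G G (fun _ v => f v)) sum_arcs_fst mul2n addnn.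
rewrite !big_split /= -!big_distrr /= big_split /= -!big_distrr /= !sum_nat_const.
rewrite -/E -triangles_sum_arcs.
rewrite (sum_ends (fun u => #|arcs (N u) (N u)|)) (sum_ends (fun u => #|N u|)).
have cauchy_schwarz : E ^ 2 <= m * \sum_(u in G) #|N u| * #|N u|.
  have := power_mean (mem G) (fun u => #|N u|) 1; rewrite /E card_arcs expn1.
  by under [X in _ <= _ * X -> _]eq_bigr do rewrite -mulnn.
have inner_le : \sum_(u in G) #|N u| * #|arcs (N u) (N u)| <= m * triangles G.
  rewrite /triangles big_distrr; apply: leq_sum => u _.
  rewrite leq_mul2r subset_leq_card ?orbT //.
  by apply/subsetP => w; rewrite inE => /andP[].
have := leq_mul (leqnn E) cauchy_schwarz; have := leq_mul (leqnn E) inner_le.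
lia.
Qed.

Definition bipartition_defect G X Y : nat :=
  #|G| * (#|G :\: (X :|: Y)| + #|X :&: Y|) + (#|arcs X X| + #|arcs Y Y|).

Lemma exists_near_bipartition G :
  let m := #|G| in let E := #|arcs G G| in
  0 < E ->
  exists X Y, [/\ X \subset G, Y \subset G &
    E * bipartition_defect G X Y + 2 * E ^ 2 <= E * m ^ 2 + 4 * m * triangles G].
Proof.
move=> m E /exists_spanning_arc[p _ le_p].
have sub_G u : neighbours G u \subset G by apply/subsetP => v; rewrite inE => /andP[].
set X := neighbours G p.1 in le_p *; set Y := neighbours G p.2 in le_p *.
have mE : m = #|X :|: Y| + #|G :\: (X :|: Y)|.
  by rewrite /m -(cardsID (X :|: Y) G) (setIidPr _) // subUset !sub_G.
exists X, Y; split; rewrite ?sub_G //; move: le_p.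
rewrite -(cardsUI X Y) /bipartition_defect -/m -/E -(mulnn m) {3}mE; lia.
Qed.

End Arcs.

(** * The disjointness graph *)

Definition disjointness (T : finType) : rel {set T} := fun A B => [disjoint A & B].
Arguments disjointness : clear implicits.

Lemma disjointness_sym (T : finType) : symmetric (disjointness T).
Proof. by move=> A B; rewrite /disjointness disjoint_sym. Qed.

(* A disjoint pair of subsets of [W] is a map from [W] to a set of three labels. *)
Lemma card_disjoint_subsets (T : finType) (W : {set T}) :
  #|arcs (disjointness T) (powerset W) (powerset W)| <= 3 ^ #|W|.
Proof.
pose label (p : {set T} * {set T}) : {ffun T -> 'I_3} :=
  [ffun x => if x \in p.1 then inord 1 else if x \in p.2 then inord 2 else ord0].
set D := arcs _ _ _.
have label_inj : {in D &, injective label}.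
  have decode p x : p \in D ->
      (x \in p.1) = (label p x == 1 :> nat) /\ (x \in p.2) = (label p x == 2 :> nat).
    rewrite !inE ffunE => /andP[_ dis_p]; have := disjointFr dis_p (x := x).
    by case: (x \in p.1) => [/(_ isT) ->|_]; last case: (x \in p.2); rewrite /= ?inordK.
  move=> [A B] [A' B'] pD qD eq_label.
  by congr pair; apply/setP => x; have /= [decA decB] := decode _ x pD;
     have /= [decA' decB'] := decode _ x qD; rewrite ?decA ?decA' ?decB ?decB' eq_label.
rewrite -(card_in_imset label_inj) -[3 in X in _ <= X](card_ord 3) -(card_pffun_on ord0).
apply/subset_leq_card/subsetP => _ /imsetP[[A B] + ->].
rewrite !inE /= => /andP[/andP[sAW sBW] _]; apply/pffun_onP; split=> //.
apply/subsetP => x; rewrite inE ffunE /=.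
case: ifP => [/(subsetP sAW) //|_]; case: ifP => [/(subsetP sBW) //|_].
by rewrite eqxx.
Qed.

Lemma card_arcs_disjoint_bigcup (T I : finType) (G : {set {set T}}) (a : {ffun I -> {set T}}) :
  let N := neighbours (disjointness T) G in
  #|[set p in arcs (disjointness T) G G | [forall i, a i \in N p.1 :&: N p.2]]|
    <= 3 ^ #|~: \bigcup_i a i|.
Proof.
apply: leq_trans (card_disjoint_subsets _); apply/subset_leq_card/subsetP => p.
rewrite !inE => /andP[/andP[_ ->] /forallP in_N]; rewrite andbT.
have sub_setC (C : {set T}) : (forall i, [disjoint C & a i]) -> C \subset ~: \bigcup_i a i.
  by move=> dis; rewrite -disjoints_subset bigcup_disjoint // => i _; exact: dis.
by apply/andP; split; apply: sub_setC => i;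
  have := in_N i; rewrite !inE => /andP[/andP[_ ?] /andP[_ ?]].
Qed.

(* Replacing one vertex of a triangle by a [t.+1]-tuple: the union of the tuple
   rarely has at most [r] elements, and otherwise the other two vertices are
   disjoint subsets of its complement. *)
Lemma triangles_blow_up (T : finType) (G : {set {set T}}) (t r : nat) :
  triangles (disjointness T) G ^ t.+1 <= (#|G| ^ 2) ^ t *
    (#|G| ^ 2 * (2 ^ #|T| * (2 ^ r) ^ t.+1) + #|G| ^ t.+1 * 3 ^ (#|T| - r.+1)).
Proof.
set D := arcs (disjointness T) G G.
have leD : #|D| <= #|G| ^ 2 by rewrite -mulnn leq_card_arcs.
rewrite triangles_sum_arcs; apply: leq_trans (leq_expn_sum_card_ffun _ _ _) _.
apply: leq_mul; first by case: t => // t; rewrite leq_exp2r.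
set common := fun a : {ffun _ -> _} => _.
pose small := [set a : {ffun 'I_t.+1 -> {set T}} | #|\bigcup_i a i| <= r].
rewrite (bigID (mem small)) /=; apply: leq_add.
  apply: (@leq_trans (\sum_(a in small) #|G| ^ 2)).
    apply: leq_sum => a _; apply: leq_trans leD.
    by apply/subset_leq_card/subsetP => p; rewrite inE => /andP[].
  rewrite sum_nat_const mulnC leq_mul2l -[t.+1 in X in _ <= X]card_ord.
  by rewrite card_ffun_small_bigcup orbT.
apply: (@leq_trans (\sum_(a | a \in ffun_on_mem 'I_t.+1 (mem G)) 3 ^ (#|T| - r.+1)));
  last first.
  by rewrite sum_nat_const card_ffun_on card_ord.
rewrite [X in _ <= X]big_mkcond [X in X <= _]big_mkcond; apply: leq_sum => a _.
case: ifP => //; rewrite inE -ltnNge => large_a.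
case: ifP => [_|/ffun_onP not_G]; last first.
  rewrite leqn0 cards_eq0; apply/set0Pn => -[p]; rewrite !inE => /andP[_ /forallP in_N].
  by apply: not_G => i; have := in_N i; rewrite !inE => /andP[/andP[]].
apply: leq_trans (card_arcs_disjoint_bigcup G a) _.
by rewrite leq_exp2l // cardsCs setCK leq_sub2l.
Qed.

Lemma leq_mul_exp3_exp2 (c n : nat) :
  c ^ 5 * 3 ^ 3 <= n -> c * 3 ^ (n - ((2 * n) %/ 5).+1) <= 2 ^ n.
Proof.
move=> n_ge; rewrite -(leq_exp2r _ _ (isT : 0 < 5)) expnMn -(expnM 2) [n * 5]mulnC (expnM 2).
apply: leq_trans (leq_mul_expn_gap (isT : 0 < 3 ^ 3) (isT : 3 ^ 3 < 2 ^ 5) n_ge).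
rewrite leq_mul2l; apply/orP; right.
by rewrite -!expnM leq_exp2l //; clear; lia.
Qed.

(* With tuples of size 20 and [r] about [2 * n / 5], both terms of
   [triangles_blow_up] are small, as [3 ^ 3 < 2 ^ 5]. *)
Lemma few_triangles (K : nat) :
  exists n0, forall (T : finType) (G : {set {set T}}),
    n0 <= #|T| -> 2 ^ #|T| <= 2 * #|G| ^ 2 ->
    K * triangles (disjointness T) G <= #|G| ^ 3.
Proof.
exists ((4 * K ^ 20) ^ 5 * 3 ^ 3 + 2 ^ 11 * K ^ 20) => T G n_ge leG.
set n := #|T| in n_ge leG *; set m := #|G| in leG *; pose r := (2 * n) %/ 5.
have := triangles_blow_up G 19 r; rewrite -/n -/m.
have le_gap : 4 * K ^ 20 * 3 ^ (n - r.+1) <= 2 ^ n.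
  by rewrite leq_mul_exp3_exp2 // (leq_trans _ n_ge) // leq_addr.
have K_small : 2 ^ 11 * K ^ 20 <= 2 ^ n.
  by rewrite (leq_trans _ (ltnW (ltn_expl n _))) // (leq_trans _ n_ge) // leq_addl.
have small_le : (2 ^ r) ^ 20 <= (2 ^ n) ^ 8 by rewrite -!expnM leq_exp2l // /r; clear; lia.
have small_term : 2 * K ^ 20 * (2 ^ n * (2 ^ r) ^ 20) <= m ^ 20.
  have le_m20 : (2 ^ n) ^ 10 <= 2 ^ 10 * m ^ 20 by rewrite (expnM m 2 10) -expnMn leq_exp2r.
  rewrite -(leq_pmul2l (isT : 0 < 2 ^ 10)); apply: leq_trans le_m20.
  rewrite 2!expnS [2 ^ 10 * _]mulnA [2 ^ 10 * _]mulnA -expnSr.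
  by rewrite leq_mul ?K_small // leq_mul.
have large_term : 2 * K ^ 20 * 3 ^ (n - r.+1) <= m ^ 2.
  by move: le_gap leG; clear; move: (K ^ 20) (3 ^ _) (m ^ 2); lia.
move=> triangles_le; rewrite -(leq_exp2r _ _ (isT : 0 < 20)) expnMn.
apply: leq_trans (leq_mul (leqnn _) triangles_le) _.
have -> : (m ^ 3) ^ 20 = (m ^ 2) ^ 19 * (m ^ 2 * m ^ 20) by rewrite -!expnM -!expnD.
rewrite mulnCA leq_mul2l; apply/orP; right; rewrite -(leq_pmul2l (isT : 0 < 2)).
have := leq_mul (leqnn (m ^ 2)) small_term; have := leq_mul (leqnn (m ^ 20)) large_term.
clear; move: (K ^ 20) (m ^ 2) (m ^ 20) (3 ^ _) (2 ^ n * _); lia.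
Qed.

(** * Families generated by disjoint unions *)

Definition generates (T : finType) (G Z : {set {set T}}) : Prop :=
  forall C, C \in Z -> exists A B, [/\ A \in G, B \in G, [disjoint A & B] & C = A :|: B].

Section Generation.

Variables (T : finType) (G Z : {set {set T}}).
Hypothesis gen : generates G Z.
Local Notation arcs := (arcs (disjointness T)).

Lemma card_generated : #|Z| <= #|G| ^ 2.
Proof.
rewrite -mulnn -cardsX; apply: leq_trans (leq_imset_card (fun p => p.1 :|: p.2) _).
apply/subset_leq_card/subsetP => C /gen[A [B [AG BG _ ->]]].
by apply/imsetP; exists (A, B); rewrite // inE AG.
Qed.

(* A nonempty member of [Z] comes from an arc and from its reverse. *)
Lemma card_generated_arcs : 2 * #|Z| <= #|arcs G G| + 2.
Proof.
pose union (p : {set T} * {set T}) := p.1 :|: p.2.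
have -> : #|arcs G G| = \sum_C #|[set p in arcs G G | union p == C]|.
  rewrite -sum1_card (partition_big union predT) //=; apply: eq_bigr => C _.
  by rewrite -sum1_card; apply: eq_bigl => p; rewrite inE.
have le_Z : #|Z| <= #|Z :\ set0| + 1 by rewrite (cardsD1 set0 Z) addnC leq_add2l leq_b1.
apply: (@leq_trans (#|Z :\ set0| * 2 + 2)); first by lia.
rewrite leq_add2r -sum_nat_const big_mkcond; apply: leq_sum => C _.
case: ifP => //; rewrite in_setD1 => /andP[C_neq0 /gen[A [B [AG BG dAB C_AB]]]].
have dBA : [disjoint B & A] by rewrite disjoint_sym.
apply/card_gt1P; exists (A, B), (B, A); split.
- by rewrite !inE /union /= AG BG -C_AB eqxx /disjointness dAB.
- by rewrite !inE /union /= AG BG setUC -C_AB eqxx /disjointness dBA.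
apply: contra C_neq0 => /eqP[eq_AB _]; rewrite C_AB eq_AB setUid.
by move: dAB; rewrite eq_AB -setI_eq0 setIid.
Qed.

Lemma card_generated_split (X Y W : {set {set T}}) :
  #|Z :&: W| <= #|G| * #|G :\: (X :|: Y)| + (#|arcs X X| + #|arcs Y Y|)
    + #|[set p in arcs X Y | p.1 :|: p.2 \in W]|.
Proof.
rewrite -cardsX; set out := setX _ _; set cross := [set _ in _ | _].
pose union (p : {set T} * {set T}) := p.1 :|: p.2.
have le_cardU (P Q : {set {set T} * {set T}}) : #|P :|: Q| <= #|P| + #|Q|.
  exact: (leq_card_setU _ _).1.
apply: (@leq_trans #|union @: (out :|: (arcs X X :|: arcs Y Y) :|: cross)|); last first.
  apply: leq_trans (leq_imset_card _ _) _; apply: leq_trans (le_cardU _ _) _.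
  by rewrite leq_add2r (leq_trans (le_cardU _ _)) // leq_add2l.
apply/subset_leq_card/subsetP => C; rewrite inE => /andP[/gen[A [B [AG BG]]]].
rewrite -/(disjointness T A B) => dAB C_AB CW.
have dBA : disjointness T B A by rewrite disjointness_sym.
have C_BA : C = B :|: A by rewrite setUC.
apply/imsetP.
have [AX|AnX] := boolP (A \in X); have [BX|BnX] := boolP (B \in X).
- by exists (A, B); rewrite // !inE /= AX BX dAB !orbT.
- have [BY|BnY] := boolP (B \in Y).
    by exists (A, B); rewrite // !inE /= AX BY dAB -C_AB CW !orbT.
  by exists (A, B); rewrite // !inE /= AG BG (negPf BnX) (negPf BnY).
- have [AY|AnY] := boolP (A \in Y).
    by exists (B, A); rewrite // !inE /= BX AY dBA -C_BA CW !orbT.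
  by exists (B, A); rewrite // !inE /= AG BG (negPf AnX) (negPf AnY).
have [AY|AnY] := boolP (A \in Y); last first.
  by exists (B, A); rewrite // !inE /= AG BG (negPf AnX) (negPf AnY).
have [BY|BnY] := boolP (B \in Y); last first.
  by exists (A, B); rewrite // !inE /= AG BG (negPf BnX) (negPf BnY).
by exists (A, B); rewrite // !inE /= AY BY dAB !orbT.
Qed.

Hypothesis leZ : #|~: Z| <= #|G|.

Lemma leq_powT_generators : 2 ^ #|T| <= #|G| + #|G| ^ 2.
Proof. by rewrite -card_sets -(cardsC Z) addnC leq_add // card_generated. Qed.

Lemma leq_card_generators (k : nat) : k + k ^ 2 <= #|T| -> k <= #|G|.
Proof.
move=> n_ge; rewrite leqNgt; apply/negP => lt_k.
have : #|G| ^ 2 <= k ^ 2 by rewrite leq_exp2r // ltnW.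
have := leq_powT_generators; have := ltn_expl #|T| (isT : 1 < 2).
by move: lt_k n_ge; lia.
Qed.

End Generation.

Definition frequent (T : finType) (t : nat) (X : {set {set T}}) : {set T} :=
  [set x | t <= #|[set A in X | x \in A]|].

Lemma card_meeting_frequent (T : finType) (t : nat) (X Y : {set {set T}}) :
  t * #|Y :\: powerset (~: frequent t X)| + #|arcs (disjointness T) X Y| <= #|X| * #|Y|.
Proof.
set P := powerset _.
rewrite (card_arcsC (@disjointness_sym T)) card_arcs mulnC [#|X| * _]mulnC -!sum_nat_const.
rewrite [X in _ + X <= _](big_setID P) [X in _ <= X](big_setID P) /= addnCA.
apply: leq_add.
  by apply: leq_sum => B _; apply/subset_leq_card/subsetP => A; rewrite inE => /andP[].
rewrite -big_split; apply: leq_sum => B /=; rewrite !inE -disjoints_subset -setI_eq0.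
case/andP=> /set0Pn[x]; rewrite !inE => /andP[xB freq_x] _.
rewrite -(cardsID [set A in X | x \in A] X) leq_add //.
  apply: leq_trans freq_x _; apply/subset_leq_card/subsetP => A.
  by rewrite !inE => /andP[-> ->].
apply/subset_leq_card/subsetP => A; rewrite !inE => /andP[AX dBA]; rewrite AX andbT /=.
by rewrite (disjointFr dBA).
Qed.

(* If [k < l] then [2 ^ k + 2 ^ l] is at least [3 / sqrt 2] times the square root
   of [2 ^ (k + l)], which is too much for [a + b]. *)
Lemma eq_exponents_of_filled_cubes (k l a b : nat) :
  a <= 2 ^ k -> b <= 2 ^ l -> 24 * 2 ^ (k + l) <= 25 * (a * b) ->
  10 * (a + b) ^ 2 <= 41 * 2 ^ (k + l) -> k = l.
Proof.
wlog le_kl : k l a b / k <= l.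
  move=> wlog_kl le_a le_b full sum_small; case/orP: (leq_total k l) => le_kl.
    exact: (wlog_kl k l a b).
  by apply/esym/(wlog_kl l k b a); rewrite // ?[l + k]addnC 1?[b * a]mulnC 1?[b + a]addnC.
move=> le_a le_b; rewrite expnD => full sum_small.
apply/eqP; rewrite eqn_leq le_kl leqNgt; apply/negP => lt_kl.
have double : 2 * 2 ^ k <= 2 ^ l by rewrite -expnS leq_exp2l.
have x_gt0 : 0 < 2 ^ k by rewrite expn_gt0.
move: (2 ^ k) (2 ^ l) x_gt0 double le_a le_b full sum_small.
move=> x y x_gt0 double le_a le_b full.
have fill_a : 24 * x <= 25 * a by nia.
have fill_b : 24 * y <= 25 * b by nia.
have : 9 * (x * y) <= 2 * (x + y) ^ 2 by nia.
have : 24 ^ 2 * (x + y) ^ 2 <= 25 ^ 2 * (a + b) ^ 2.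
  by rewrite -!expnMn leq_exp2r //; lia.
have : 0 < x * y by nia.
lia.
Qed.

Definition straddling (T : finType) (G : {set {set T}}) (S : {set T}) : {set {set T}} :=
  G :\: (powerset S :|: powerset (~: S)).

Section NearBipartition.

Variables (T : finType) (G Z X Y : {set {set T}}) (s t : nat).
Local Notation arcs := (arcs (disjointness T)).

(* A single slack [s] absorbs all the error terms; [t] is about [#|G| / 32]. *)
Hypotheses (gen : generates G Z) (leZ : #|~: Z| <= #|G|).
Hypotheses (sXG : X \subset G) (sYG : Y \subset G).
Hypothesis defect_small : bipartition_defect (disjointness T) G X Y <= s.
Hypothesis G_small : #|G| ^ 2 <= 4 * 2 ^ #|T| + s.
Hypotheses (G_gt0 : 0 < #|G|) (G_le_s : #|G| <= s) (s_small : 10 ^ 5 * s <= #|G| ^ 2).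
Hypotheses (t_le : 32 * t <= #|G|) (t_ge : #|G| <= 33 * t).

Lemma uncovered_inner_leq :
  #|G| * #|G :\: (X :|: Y)| + (#|arcs X X| + #|arcs Y Y|) <= s.
Proof. by apply: leq_trans defect_small; rewrite leq_add2r leq_mul2l leq_addr orbT. Qed.

Lemma leq_card_crossing_unions (W : {set {set T}}) :
  #|W| <= 2 * s + #|[set p in arcs X Y | p.1 :|: p.2 \in W]|.
Proof.
have := card_generated_split gen X Y W; set cross := #|[set _ in _ | _]|.
have : #|W :\: Z| <= #|G|.
  by apply: leq_trans leZ; apply: subset_leq_card; rewrite setDE subsetIr.
have := cardsID Z W; rewrite setIC.
by have := uncovered_inner_leq; move: G_le_s; lia.
Qed.

Lemma leq_powT_card_arcs : 2 ^ #|T| <= 2 * s + #|arcs X Y|.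
Proof.
rewrite -card_sets -cardsT; apply: leq_trans (leq_card_crossing_unions _) _.
by rewrite leq_add2l; apply/subset_leq_card/subsetP => p; rewrite inE => /andP[].
Qed.

Lemma leq_card_setX_arcs : #|X| * #|Y| <= #|arcs X Y| + 3 * s.
Proof.
have leXY : #|X| + #|Y| <= #|G| + #|X :&: Y|.
  by rewrite -cardsUI leq_add2r subset_leq_card // subUset sXG.
have cap_small : #|G| * #|X :&: Y| <= s.
  by apply: leq_trans defect_small; rewrite /bipartition_defect mulnDr -addnA addnCA leq_addr.
have cap_leG : #|X :&: Y| <= #|G| by apply: subset_leq_card; rewrite subIset ?sXG.
have agm : 4 * (#|X| * #|Y|) <= #|G| ^ 2 + 3 * s.
  apply: leq_trans (nat_AGM2 _ _).1 _.
  apply: (@leq_trans ((#|G| + #|X :&: Y|) ^ 2)); first by rewrite leq_exp2r.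
  have := leq_mul cap_leG (leqnn #|X :&: Y|); rewrite mulnn sqrnD; move: cap_small; lia.
by have := leq_powT_card_arcs; move: G_small agm; lia.
Qed.

Lemma frequent_cover : frequent t X :|: frequent t Y = setT.
Proof.
apply/setP => x; rewrite !inE.
case: leqP => //= freq_x; case: leqP => //= freq_x'; exfalso.
pose W : {set {set T}} := [set C : {set T} | x \in C].
have := leq_card_crossing_unions W; have : 2 ^ #|T| = 2 * #|W| := card_sets_containing x.
set cross := [set p in arcs X Y | _].
have le_cross : #|cross| <=
    #|[set A in X | x \in A]| * #|Y| + #|X| * #|[set A in Y | x \in A]|.
  rewrite -!cardsX; apply: leq_trans (leq_card_setU _ _).1; apply: subset_leq_card.
  apply/subsetP => p; rewrite !inE /= => /andP[/andP[/andP[-> ->] _]].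
  by rewrite !andbT.
have le_left : 32 * (#|[set A in X | x \in A]| * #|Y|) <= #|G| ^ 2.
  rewrite -mulnn mulnA leq_mul ?subset_leq_card //.
  by rewrite (leq_trans _ t_le) // leq_mul2l ltnW.
have le_right : 32 * (#|X| * #|[set A in Y | x \in A]|) <= #|G| ^ 2.
  rewrite -mulnn mulnCA leq_mul ?subset_leq_card //.
  by rewrite (leq_trans _ t_le) // leq_mul2l ltnW.
by move: le_cross le_left le_right G_small s_small G_gt0 G_le_s; lia.
Qed.

Local Notation S := (frequent t X).

Lemma right_mostly_below_frequentC : #|G| * #|Y :\: powerset (~: S)| <= 99 * s.
Proof.
have := leq_mul t_ge (leqnn #|Y :\: powerset (~: S)|).
by have := card_meeting_frequent t X Y; have := leq_card_setX_arcs; lia.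
Qed.

Lemma left_mostly_below_frequent : #|G| * #|X :\: powerset S| <= 99 * s.
Proof.
have subC : X :\: powerset S \subset X :\: powerset (~: frequent t Y).
  rewrite setDS // powersetS; apply/subsetP => x; have := in_setT x.
  by rewrite -frequent_cover in_setU in_setC; case: (x \in frequent t Y); rewrite ?orbF.
have := leq_mul t_ge (subset_leq_card subC).
have := card_meeting_frequent t Y X; rewrite (card_arcsC (@disjointness_sym T)).
by have := leq_card_setX_arcs; lia.
Qed.

Lemma card_straddling_frequent : #|G| * #|straddling G S| <= 200 * s.
Proof.
have : #|straddling G S| <=
    #|G :\: (X :|: Y)| + #|X :\: powerset S| + #|Y :\: powerset (~: S)|.
  apply: leq_trans (leq_add (leq_card_setU _ _).1 (leqnn _)).
  apply: leq_trans (leq_card_setU _ _).1; apply/subset_leq_card/subsetP => A.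
  rewrite !in_setU !in_setD !in_setU negb_or.
  by case/andP=> /andP[-> ->] ->; case: (A \in X); case: (A \in Y).
move=> /(leq_mul (leqnn #|G|)); rewrite !mulnDr; have := uncovered_inner_leq.
by have := left_mostly_below_frequent; have := right_mostly_below_frequentC; lia.
Qed.

Lemma leq_powT_card_cubes :
  2 ^ #|T| <= #|G :&: powerset S| * #|G :&: powerset (~: S)| + 200 * s.
Proof.
have le_arcs : #|arcs X Y| <= #|X :\: powerset S| * #|Y| + #|X| * #|Y :\: powerset (~: S)|
    + #|G :&: powerset S| * #|G :&: powerset (~: S)|.
  rewrite -!cardsX; apply: leq_trans (leq_add (leq_card_setU _ _).1 (leqnn _)).
  apply: leq_trans (leq_card_setU _ _).1; apply/subset_leq_card/subsetP => -[A B].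
  rewrite in_set !in_setU !in_setX !in_setD !in_setI /= => /andP[/andP[AX BY] _].
  rewrite AX BY (subsetP sXG _ AX) (subsetP sYG _ BY) /=.
  by case: (A \in powerset S); case: (B \in powerset _).
have := leq_mul (leqnn #|X :\: powerset S|) (subset_leq_card sYG).
have := leq_mul (subset_leq_card sXG) (leqnn #|Y :\: powerset (~: S)|).
have := left_mostly_below_frequent; have := right_mostly_below_frequentC.
by have := leq_powT_card_arcs; lia.
Qed.

Lemma card_frequent_half : #|S| = #|~: S|.
Proof.
have cardS : #|T| = #|S| + #|~: S| by rewrite cardsC.
have := leq_powT_card_cubes; set a := #|_ :&: _|; set b := #|_ :&: _| => ab_large.
have ab_small : a + b <= #|G| + 1.
  rewrite /a /b -cardsUI -setIUr leq_add ?subset_leq_card ?subsetIl //.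
  rewrite -(cards1 (set0 : {set T})) subset_leq_card //; apply/subsetP => A.
  rewrite !inE => /andP[/andP[_ AS] /andP[_ AC]].
  by rewrite -subset0 -(setICr S) subsetI AS AC.
apply: (@eq_exponents_of_filled_cubes _ _ a b).
- by rewrite -card_powerset subset_leq_card ?subsetIr.
- by rewrite -card_powerset subset_leq_card ?subsetIr.
- by rewrite -cardS; move: ab_large G_small s_small; lia.
rewrite -cardS; have : (a + b) ^ 2 <= (#|G| + 1) ^ 2 by rewrite leq_exp2r.
by rewrite sqrnD; move: G_small s_small G_le_s; lia.
Qed.

Lemma frequent_halving_cubes : #|S| = #|~: S| /\ #|G| * #|straddling G S| <= 200 * s.
Proof. by split; [exact: card_frequent_half | exact: card_straddling_frequent]. Qed.

End NearBipartition.

(* As [Z] is almost everything, there are almost [#|G| ^ 2 / 2] arcs, which makes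
   the bound of [exists_near_bipartition] nearly tight. *)
Lemma exists_generated_bipartition (T : finType) (G Z : {set {set T}}) (s : nat) :
  generates G Z -> #|~: Z| <= #|G| ->
  0 < #|G| -> #|G| <= s -> 18 * s <= #|G| ^ 2 -> #|G| ^ 2 <= 4 * 2 ^ #|T| + s ->
  16 * triangles (disjointness T) G <= #|G| * s ->
  exists X Y : {set {set T}}, [/\ X \subset G, Y \subset G &
    bipartition_defect (disjointness T) G X Y <= 10 * s].
Proof.
move=> gen leZ G_gt0 G_le_s s_small G_small few.
set E := #|arcs (disjointness T) G G|.
have E_large : #|G| ^ 2 <= 2 * E + 9 * s.
  have := card_generated_arcs gen; have := cardsC Z; rewrite card_sets -/E.
  by move: G_small leZ G_le_s G_gt0; lia.
have E_gt0 : 0 < E by lia.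
have [X [Y [sXG sYG defect]]] := exists_near_bipartition (@disjointness_sym T) E_gt0.
exists X, Y; split=> //; rewrite -(leq_pmul2l E_gt0).
set D := bipartition_defect _ _ _ _ in defect *.
have {}defect :
    E * D + 2 * E ^ 2 <= E * #|G| ^ 2 + 4 * #|G| * triangles (disjointness T) G.
  exact: defect.
have triangles_le : 4 * #|G| * triangles (disjointness T) G <= E * s.
  have := leq_mul (leqnn #|G|) few.
  have : #|G| ^ 2 * s <= (4 * E) * s by rewrite leq_mul2r; apply/orP; right; lia.
  by lia.
have := leq_mul (leqnn E) E_large.
by lia.
Qed.

Lemma exists_halving_cubes (T : finType) (G Z : {set {set T}}) (s : nat) :
  generates G Z -> #|~: Z| <= #|G| ->
  0 < #|G| -> #|G| <= s -> 10 ^ 6 * s <= #|G| ^ 2 -> #|G| ^ 2 <= 4 * 2 ^ #|T| + s ->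
  16 * triangles (disjointness T) G <= #|G| * s ->
  exists S : {set T}, #|S| = #|~: S| /\ #|G| * #|straddling G S| <= 2000 * s.
Proof.
move=> gen leZ G_gt0 G_le_s s_small G_small few.
have [|X [Y [sXG sYG defect]]] :=
  exists_generated_bipartition gen leZ G_gt0 G_le_s _ G_small few.
  by move: s_small; lia.
have G_small10 : #|G| ^ 2 <= 4 * 2 ^ #|T| + 10 * s by lia.
have G_le_s10 : #|G| <= 10 * s by lia.
have s10_small : 10 ^ 5 * (10 * s) <= #|G| ^ 2 by move: s_small; lia.
pose t := #|G| %/ 32; have t_le : 32 * t <= #|G| by rewrite mulnC leq_divM.
have t_ge : #|G| <= 33 * t.
  have : 10 ^ 6 * #|G| <= #|G| * #|G|.
    by rewrite mulnn; apply: leq_trans s_small; rewrite leq_mul2l G_le_s orbT.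
  by rewrite leq_pmul2r // /t; lia.
have [cardS few_straddling] :=
  frequent_halving_cubes gen leZ sXG sYG defect G_small10 G_gt0 G_le_s10 s10_small t_le t_ge.
by exists (frequent t X); split=> //; move: few_straddling; rewrite mulnA.
Qed.

Lemma generators_near_cubes (L : nat) :
  exists c N, 0 < c /\ forall (T : finType) (G Z : {set {set T}}),
    N <= #|T| -> generates G Z -> #|~: Z| <= #|G| ->
    c * #|G| ^ 2 <= (c + 1) * (4 * 2 ^ #|T|) ->
    exists S : {set T}, #|S| = #|~: S| /\ L * (#|straddling G S| + 2) <= #|G|.
Proof.
have [c [c_large L_le]] : exists c, 10 ^ 6 <= c /\ 4000 * L <= c.
  by exists (10 ^ 6 + 4000 * L); rewrite leq_addr leq_addl.
have c_gt0 : 0 < c by lia.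
have [n0 few] := few_triangles (32 * c).
exists c, (n0 + (c + c ^ 2)); split=> // T G Z n_ge gen leZ G_small.
have G_ge : c <= #|G|.
  by apply: (leq_card_generators gen leZ); apply: leq_trans n_ge; exact: leq_addl.
have G_gt0 : 0 < #|G| by apply: leq_trans c_gt0 G_ge.
pose s := #|G| ^ 2 %/ c.
have s_le : c * s <= #|G| ^ 2 by rewrite mulnC leq_divM.
have s_ge : #|G| ^ 2 < c * (s + 1) by rewrite mulnC addn1 ltn_ceil.
have G_le_s : #|G| <= s by rewrite leq_divRL // -mulnn leq_mul2l G_ge orbT.
have s_small : 10 ^ 6 * s <= #|G| ^ 2 by apply: leq_trans s_le; rewrite leq_mul2r c_large orbT.
have G_le_pow : #|G| ^ 2 <= 4 * 2 ^ #|T| + s by exact: leq_add_divn.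
have triangles_le : 16 * triangles (disjointness T) G <= #|G| * s.
  have powT_le : 2 ^ #|T| <= 2 * #|G| ^ 2.
    apply: leq_trans (leq_powT_generators gen leZ) _.
    by rewrite mul2n -addnn leq_add2r -mulnn leq_pmulr.
  rewrite -(leq_pmul2l c_gt0).
  have := few T G (leq_trans (leq_addr _ _) n_ge) powT_le.
  have := leq_mul (leqnn #|G|) (ltnW s_ge); rewrite -expnS.
  have := leq_mul (leqnn (#|G| * c)) (leq_trans G_gt0 G_le_s).
  by move: (#|G| ^ 3) => cube; lia.
have [S [cardS few_straddling]] :=
  exists_halving_cubes gen leZ G_gt0 G_le_s s_small G_le_pow triangles_le.
exists S; split=> //; rewrite -(leq_pmul2l G_gt0).
have := leq_mul L_le (leqnn s); have := leq_mul (leqnn L) few_straddling.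
have := leq_mul (leqnn #|G|) (leq_trans L_le G_ge); rewrite mulnn; move: s_le.
by move: (#|G| ^ 2) => q; lia.
Qed.

(** * Maximal intersecting families *)

Lemma maximal_kwise_blocked (n k : nat) (F : {set {set 'I_n}}) (C : {set 'I_n}) :
  maximal_kwise_intersecting k F -> C \notin F ->
  exists G : {set {set 'I_n}},
    [/\ G \subset F, #|G| < k & C :&: \bigcap_(A in G) A = set0].
Proof.
move=> [kF maxF] CF.
case: (boolP [exists G : {set {set 'I_n}},
  [&& G \subset F, #|G| < k & C :&: \bigcap_(A in G) A == set0]]).
  by case/existsP=> G /and3P[? ? /eqP]; exists G.
rewrite negb_exists => /forallP not_blocked; case: (maxF C CF) => G sGCF card_G.
have sGF : G :\ C \subset F by rewrite subDset.
have [CG|CnG] := boolP (C \in G); last first.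
  apply: kF card_G; apply: subset_trans sGF; apply/subsetP => A AG.
  by rewrite !inE AG andbT; apply: contraNneq CnG => <-.
have card_GC : #|G :\ C| < k by case/andP: card_G => _; rewrite (cardsD1 C) CG.
have := not_blocked (G :\ C); rewrite sGF card_GC /= => /set0Pn[x].
rewrite inE => /andP[xC /bigcapP xG]; exists x => A AG.
by have [-> //|AnC] := eqVneq A C; apply: xG; rewrite !inE AnC.
Qed.

Lemma maximal_kwise_upset (n k : nat) (F : {set {set 'I_n}}) (A B : {set 'I_n}) :
  maximal_kwise_intersecting k F -> A \in F -> A \subset B -> B \in F.
Proof.
move=> maxF AF sAB; apply: contraT => BF.
have [G [sGF card_G capG]] := maximal_kwise_blocked maxF BF.
have [||x xAG] := maxF.1 (A |: G).
- by rewrite subUset sub1set AF.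
- rewrite card_gt0; apply/andP; split; first by apply/set0Pn; exists A; rewrite setU11.
  by rewrite cardsU1 (leq_trans _ card_G) // -add1n leq_add2r leq_b1.
have : x \in B :&: \bigcap_(E in G) E; last by rewrite capG inE.
rewrite inE (subsetP sAB x (xAG A (setU11 A G))); apply/bigcapP => E EG.
by apply: xAG; rewrite setU1r.
Qed.

Lemma maximal_kwise_setT (n k : nat) (F : {set {set 'I_n}}) :
  0 < n -> maximal_kwise_intersecting k F -> setT \in F.
Proof.
move=> n_gt0 maxF; apply: contraT => TF.
have [G [sGF card_G]] := maximal_kwise_blocked maxF TF; rewrite setTI => capG.
have [G0|/set0Pn[A AG]] := eqVneq G set0.
  by have := in_set0 (Ordinal n_gt0); rewrite -capG G0 big_set0 inE.
have [||x xG] := maxF.1 G => //.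
  by rewrite (ltnW card_G) andbT card_gt0; apply/set0Pn; exists A.
by have := in_set0 x; rewrite -capG => /bigcapP[].
Qed.

Lemma maximal_3wise_blocked (n : nat) (F : {set {set 'I_n}}) (C : {set 'I_n}) :
  0 < n -> maximal_kwise_intersecting 3 F -> C \notin F ->
  exists A B, [/\ A \in F, B \in F & C :&: A :&: B = set0].
Proof.
move=> n_gt0 maxF CF; have TF := maximal_kwise_setT n_gt0 maxF.
have [G [/subsetP sGF card_G capG]] := maximal_kwise_blocked maxF CF.
have sub A : A \in enum G -> A \in F by rewrite mem_enum => /sGF.
move: card_G sub capG; rewrite -big_enum cardE.
case: (enum G) => [|A [|B []]] //= _ sub; rewrite ?big_cons big_nil => capG.
- by exists setT, setT; rewrite !setIT -[C]setIT.
- by exists A, setT; rewrite sub ?mem_head // setIT -capG setIT.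
by exists A, B; rewrite !sub ?inE ?eqxx ?orbT // -capG setIT setIA.
Qed.

Lemma maximal_3wise_generates (n : nat) (F : {set {set 'I_n}}) :
  0 < n -> maximal_kwise_intersecting 3 F ->
  generates [set ~: A | A in F] (~: F).
Proof.
move=> n_gt0 maxF C; rewrite inE => CF.
have [A [B [AF BF CAB0]]] := maximal_3wise_blocked n_gt0 maxF CF.
have complement_in D E : D \in F -> D \subset ~: E -> E \in [set ~: A | A in F].
  move=> DF sDE; apply/imsetP; exists (~: E); rewrite ?setCK //.
  exact: maximal_kwise_upset maxF DF sDE.
exists (C :\: A), (C :&: A); split.
- by apply: complement_in AF _; rewrite setCD subsetUr.
- by apply: complement_in BF _; rewrite -disjoints_subset -setI_eq0 setIC CAB0.
- by rewrite -setI_eq0 setDE setIACA [~: A :&: A]setIC setICr setI0.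
by rewrite setUC setID.
Qed.

(* [S] and its complement lie in neither cube but may belong to [F]. *)
Lemma card_minus_linked_cubes (n : nat) (F : {set {set 'I_n}}) (S : {set 'I_n}) :
  #|F :\: linked_cubes S| <= #|straddling [set ~: A | A in F] S| + 2.
Proof.
set U := straddling _ S; rewrite -(card_imset U (@setC_inj _)).
apply: (@leq_trans #|[set ~: A | A in U] :|: [set S; ~: S]|); last first.
  apply: leq_trans (leq_card_setU _ _).1 _; rewrite leq_add2l cards2.
  by case: (_ != _).
apply/subset_leq_card/subsetP => A; rewrite !inE => /andP[not_linked AF].
have [->|AS] := eqVneq A S; first by rewrite orbT.
have [->|ASC] := eqVneq A (~: S); first by rewrite !orbT.
rewrite !orbF; apply/imsetP; exists (~: A); last by rewrite setCK.
move: not_linked; rewrite !properEneq ![_ == A]eq_sym AS ASC !inE /=.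
by rewrite setCS [~: A \subset S]subCset orbC => ->; rewrite imset_f.
Qed.

Lemma INR_expn (m n : nat) : INR (m ^ n) = (INR m ^ n)%R.
Proof. by elim: n => // n IH; rewrite expnS mult_INR IH. Qed.

Lemma Rpower2_half_sqr (n : nat) :
  (Rpower 2 ((INR n + 2) / 2) * Rpower 2 ((INR n + 2) / 2) = 4 * 2 ^ n)%R.
Proof.
rewrite -Rpower_plus.
have -> : ((INR n + 2) / 2 + (INR n + 2) / 2 = INR n + INR 2)%R by rewrite /=; field.
by rewrite Rpower_plus !Rpower_pow; [rewrite /=; ring | lra..].
Qed.

Lemma leq_sqr_of_Rpower (c f n : nat) :
  0 < c -> (INR f <= (1 + / (3 * INR c)) * Rpower 2 ((INR n + 2) / 2))%R ->
  c * f ^ 2 <= (c + 1) * (4 * 2 ^ n).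
Proof.
move=> c_gt0 f_le; apply/leP/INR_le.
have c_ge1 : (1 <= INR c)%R by apply: (le_INR 1); apply/leP.
have inv_c : (INR c * / (3 * INR c) = / 3)%R by field; lra.
have inv_pos : (0 < / (3 * INR c))%R by apply: Rinv_0_lt_compat; lra.
rewrite -mulnn !mult_INR plus_INR INR_expn (INR_IZR_INZ 1) (INR_IZR_INZ 2) (INR_IZR_INZ 4) /=.
have := Rpower2_half_sqr n; have := exp_pos ((INR n + 2) / 2 * ln 2).
rewrite -/(Rpower _ _); move: (Rpower _ _) f_le => rho f_le rho_gt0 rho_sqr.
have f_sqr : (INR f * INR f <= (1 + / (3 * INR c)) ^ 2 * (4 * 2 ^ n))%R.
  by rewrite -rho_sqr; have := pos_INR f; nra.
have eta_small : (INR c * (1 + / (3 * INR c)) ^ 2 <= INR c + 1)%R by nra.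
by have := pow_lt 2 n; nra.
Qed.

Theorem theorem1p2 :
  forall eps : R, (0 < eps)%R ->
  exists eta : R, (0 < eta)%R /\
  exists N : nat, forall n : nat, (N <= n)%N ->
  forall F : {set {set 'I_n}},
    maximal_kwise_intersecting 3 F ->
    (INR #|F| <= (1 + eta) * Rpower 2 ((INR n + 2) / 2))%R ->
    ~~ odd n /\
    exists S : {set 'I_n}, balanced S /\
      (INR #|F :\: linked_cubes S| <= eps * INR #|F|)%R.
Proof.
move=> eps eps_gt0; have [L L_large] := INR_archimed eps 1 eps_gt0.
have [c [N [c_gt0 near_cubes]]] := generators_near_cubes L.
have INR_c_gt0 : (0 < INR c)%R by apply/lt_0_INR/ltP.
exists (/ (3 * INR c))%R; split; first by apply: Rinv_0_lt_compat; lra.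
exists N.+1 => n n_ge F maxF F_le.
have n_gt0 : 0 < n by apply: leq_trans n_ge.
pose G : {set {set 'I_n}} := [set ~: A | A in F].
have cardG : #|G| = #|F| by rewrite card_imset //; exact: setC_inj.
have [||||S [cardS few]] := near_cubes _ G (~: F).
- by rewrite card_ord ltnW.
- exact: maximal_3wise_generates.
- by rewrite setCK cardG.
- by rewrite cardG card_ord; exact: leq_sqr_of_Rpower.
have nE : n = #|S|.*2 by rewrite -addnn {2}cardS cardsC card_ord.
split; first by rewrite nE odd_double.
exists S; split.
  by rewrite /balanced; move: #|S| nE => k ->; rewrite doubleK uphalf_double leqnn.
have : L * #|F :\: linked_cubes S| <= #|F|.
  by rewrite -cardG; apply: leq_trans few; rewrite leq_mul2l card_minus_linked_cubes orbT.
move=> /leP/le_INR; rewrite mult_INR.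
by have := pos_INR #|F :\: linked_cubes S|; nra.
Qed.
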